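(* There is an absolute constant $C>0$ such that the following holds. Let $n\ge 2$, let $\sigma>0$, and let $(X_1,\dots,X_n)$ be a random vector in $\mathbf{R}^n$ whose distribution $\mu$ satisfies $\mathrm{PI}(\sigma^2)$. Then $$\mathbf{E}\int_{-\infty}^{+\infty}|F_n(x)-F(x)|\,dx\le C\sigma\left(\frac{A+\log n}{n}\right)^{1/3},$$ where $A=\frac1\sigma\max_{1\le i,j\le n}|\mathbf{E}X_i-\mathbf{E}X_j|$.
   Context: For a random vector $(X_1,\dots,X_n)$ in $\mathbf{R}^n$ with distribution $\mu$, the empirical distribution function is $F_n(x)=\frac1n\,\mathrm{card}\{i\le n: X_i\le x\}$ and $F(x)=\mathbf{E}F_n(x)=\frac1n\sum_{i=1}^n\mathbf{P}\{X_i\le x\}$, $x\in\mathbf{R}$. A probability measure $\mu$ on $\mathbf{R}^n$ satisfies $\mathrm{PI}(\sigma^2)$ (Poincaré-type inequality with constant $\sigma^2$) if for every bounded smooth function $g$ on $\mathbf{R}^n$, $\mathrm{Var}_\mu(g)\le\sigma^2\int|\nabla g|^2\,d\mu$, where $\mathrm{Var}_\mu(g)=\int g^2\,d\mu-(\int g\,d\mu)^2$. *)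

(* Defs.v *)
From HB Require Import structures.
From mathcomp Require Import all_boot all_order all_algebra.
From mathcomp Require Import all_classical all_reals all_analysis.

Set Implicit Arguments.
Unset Strict Implicit.
Unset Printing Implicit Defensive.

Import Order.TTheory GRing.Theory Num.Theory.
Import numFieldNormedType.Exports.

Local Open Scope classical_set_scope.
Local Open Scope ring_scope.

(* The library puts the Borel (product) sigma-algebra of R^n on n.-tuple R and
   the topology and differential structure of R^n on 'rV[R]_n; a point of the
   former is read as a point of the latter through row_of. *)
Definition row_of (R : realType) (n : nat) (x : n.-tuple R) : 'rV[R]_n :=
  \row_i tnth x i.

Definition partial (R : realType) (n : nat) (i : 'I_n) (g : 'rV[R]_n -> R)
  : 'rV[R]_n -> R := fun x => 'D_(delta_mx ord0 i) g x.

(* class C^k: the partial derivatives of order at most k exist and are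
   continuous *)
Fixpoint Ck (R : realType) (n k : nat) (g : 'rV[R]_n -> R) : Prop :=
  continuous g /\
  match k with
  | 0%N => True
  | k'.+1 => forall i : 'I_n,
      (forall x, derivable g x (delta_mx ord0 i)) /\ Ck k' (partial i g)
  end.

Definition smooth (R : realType) (n : nat) (g : 'rV[R]_n -> R) : Prop :=
  forall k, Ck k g.

(* |grad g|^2, for the Euclidean norm (the library norm on 'rV[R]_n is the
   maximum norm) *)
Definition grad_sq (R : realType) (n : nat) (g : 'rV[R]_n -> R) (x : 'rV[R]_n)
  : R := \sum_(i < n) partial i g x ^+ 2.

(* Both integrals on the left are finite, g being bounded; the one on the right
   may be +oo. *)
Definition PI (R : realType) (n : nat)
    (mu : probability (n.-tuple (measurableTypeR R)) R) (sigma2 : R) : Prop :=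
  forall g : 'rV[R]_n -> R,
    smooth g -> [bounded g x | x in [set: 'rV[R]_n]] ->
    (\int[mu]_x ((g (row_of x)) ^+ 2)%:E - (\int[mu]_x (g (row_of x))%:E) ^+ 2
     <= sigma2%:E * \int[mu]_x (grad_sq g (row_of x))%:E)%E.

Definition edf (R : realType) (n : nat) (v : n.-tuple R) (x : R) : R :=
  n%:R^-1 * #|[pred i : 'I_n | tnth v i <= x]|%:R.

Section RandomVector.
Context {d : measure_display} {T : measurableType d} {R : realType}.
Variables (P : probability T R) (n : nat).
Variable X : {RV P >-> n.-tuple (measurableTypeR R)}.

Definition mean_df (x : R) : R := fine 'E_P[fun w => edf (X w) x].

(* fine discards nothing under PI, which forces every coordinate to have a
   finite second moment *)
Definition mean_coord (i : 'I_n) : R := fine 'E_P[fun w => tnth (X w) i].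

(* the default value 0 is harmless: the terms are nonnegative *)
Definition mean_spread (sigma : R) : R :=
  sigma^-1 * \big[Num.max/0]_(i < n) \big[Num.max/0]_(j < n)
               `|mean_coord i - mean_coord j|.

End RandomVector.

(* Main.v *)
(* Smooth the empirical distribution function at scale h with the logistic
   function s, whose derivative is k = s (1 - s): the error made at x is at most
   a constant times the average D(x) of k((x - X_i)/h), and D has integral h.
   Functions of the form sum_i c_i s(a + b x_i) are bounded and smooth, so the
   Poincare inequality applies to them directly, and it bounds the variance of
   the smoothed function at x by sigma^2 D(x) / (4 n h^2).  By AM-GM, E|F_n - F|
   is bounded at x by theta/2 + (4 + sigma^2 / (8 n h^2 theta)) D(x).

   The constant term theta/2 is only affordable on a bounded interval.  For
   b = 1/(2 sigma) or -1/(2 sigma) and g = s(a + b X_i), the Poincare inequality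
   gives E g^2 <= (4/3) (E g)^2 because |g'| <= |b| g; comparing with a median of
   X_i yields E g <= C exp(a + b E X_i), that is, exponential tails.  Hence outside
   the interval of radius r = sigma (A + 2 ln n) around a mean, E|F_n - F| decays
   exponentially from the level C/n.

   With q^3 = (A + ln n)/n, h = sigma q and theta = 1/(n q^2), the three
   contributions h, theta r and sigma/n are all O(sigma q). *)
Require Import Defs.
From HB Require Import structures.
From mathcomp Require Import all_boot all_order all_algebra.
From mathcomp Require Import all_classical all_reals all_analysis.
From mathcomp Require Import measurable_realfun ring lra.

Set Implicit Arguments.
Unset Strict Implicit.
Unset Printing Implicit Defensive.

Import Order.TTheory GRing.Theory Num.Theory.
Import numFieldNormedType.Exports.
Local Open Scope classical_set_scope.
Local Open Scope ring_scope.

(** * The logistic function *)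

Definition logistic {R : realType} (u : R) : R := (1 + expR (- u))^-1.

Section logistic.
Context {R : realType}.
Implicit Types u a b : R.
Local Notation s := (@logistic R).

Let den_gt0 u : 0 < 1 + expR (- u).
Proof. by rewrite addr_gt0 ?expR_gt0. Qed.

Lemma logistic_gt0 u : 0 < s u.
Proof. by rewrite invr_gt0. Qed.

Lemma logistic_lt1 u : s u < 1.
Proof. by rewrite invf_lt1// ltrDl expR_gt0. Qed.

Lemma logisticN u : s (- u) = 1 - s u.
Proof.
rewrite /logistic opprK.
have := den_gt0 u; have := den_gt0 (- u); rewrite opprK => h1 h2.
have e : expR u * expR (- u) = 1 by rewrite -expRD subrr expR0.
field : e; by rewrite !gt_eqF.
Qed.

Lemma logistic_le_expR u : s u <= expR u.
Proof.
rewrite /logistic -[leRHS]invrK -expRN lef_pV2 ?posrE ?expR_gt0//.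
by rewrite lerDr.
Qed.

Lemma logistic_ge_half u : 0 <= u -> 2^-1 <= s u.
Proof.
move=> u0; rewrite lef_pV2 ?posrE//.
by rewrite -[2]/(1+1)%R lerD2l -expR0 ler_expR oppr_le0.
Qed.

Lemma is_derive_logistic u : is_derive u (1:R) s (s u * (1 - s u)).
Proof.
have h : is_derive u (1:R) (fun x : R => 1 + expR (- x)) (- expR (- u)).
  have h0 := is_derive1_comp (is_derive_expR (- u)) (is_deriveNid u 1).
  have h1 := is_deriveD (is_derive_cst (1:R) u 1) h0.
  by rewrite -[- expR (- u)]mulrN1 -[_ * _]add0r; exact: h1.
have h2 := @is_deriveV _ (fun x : R => 1 + expR (- x)) u _ _ (lt0r_neq0 (den_gt0 u)) h.
apply: (is_derive_eq h2).
rewrite /logistic /GRing.scale /= ; field.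
by rewrite gt_eqF.
Qed.

Lemma is_derive_horner (p : {poly R}) (x : R) :
  is_derive x (1:R) (fun y => p.[y]) p^`().[x].
Proof.
elim/poly_ind : p => [|p c ih].
  rewrite (_ : (fun _ => _) = cst 0); last by apply/funext => y; rewrite horner0.
  by rewrite deriv0 horner0; exact: is_derive_cst.
rewrite (_ : (fun _ => _) = (fun y => p.[y] * y + c)); last first.
  by apply/funext => y; rewrite hornerMXaddC.
apply: is_derive_eq.
rewrite derivMXaddC !hornerE /GRing.scale /=; ring.
Qed.

(** Since [s' = s (1 - s)], the derivative of [p(s)] is again a polynomial in [s]: this one, up to
    the slope of the inner affine map. *)
Definition logisticD_poly (p : {poly R}) : {poly R} := p^`() * ('X * (1 - 'X)).

Lemma is_derive_poly_logistic (p : {poly R}) a b y :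
  is_derive y (1:R) (fun z => p.[s (a + b * z)])
    (b *: logisticD_poly p).[s (a + b * y)].
Proof.
have h1 : is_derive y (1:R) (fun z => a + b * z) b.
  by apply: is_derive_eq; rewrite /GRing.scale /= add0r mul1r mulr1.
have h2 := @is_derive1_comp _ s (fun z => a + b * z) y _ _ (is_derive_logistic (a + b * y)) h1.
have h3 := @is_derive1_comp _ (fun z => p.[z]) _ y _ _ (is_derive_horner p (s (a + b * y))) h2.
apply: (is_derive_eq h3).
rewrite !hornerE /GRing.scale /=; ring.
Qed.

End logistic.

(** * Smoothness of sums of polynomials in the logistic function *)

Section smooth.
Context {R : realType} (n : nat).
Implicit Types (a b : R).
Local Notation s := (@logistic R).

Lemma is_derive_comp_coord (f : R -> R) df (i j : 'I_n) (x : 'rV[R]_n) :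
  is_derive (x ord0 j) (1:R) f df ->
  is_derive x (delta_mx ord0 i : 'rV[R]_n) (fun y => f (y ord0 j)) (df *+ (j == i)).
Proof.
move=> fx.
have diff_f : differentiable f (x ord0 j) by apply/derivable1_diffP; exact: ex_derive.
have dc := differentiable_coord x ord0 j.
have dfc := differentiable_comp dc diff_f.
apply: DeriveDef; first exact: diff_derivable.
rewrite deriveE// diff_comp// diff1E//= derive1E derive_val -deriveE//.
suff -> : 'D_(delta_mx ord0 i) (fun N : 'rV[R]_n => N ord0 j) x = (j == i)%:R.
  by rewrite /GRing.scale /= mulr_natl.
rewrite /derive; apply: cvg_lim => //.
(* The coordinate is linear, so its difference quotient is constant away from 0. *)
apply: (@cvg_trans _ ((fun _ : R => (j == i)%:R : R) @ 0^')); last exact: cvg_cst.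
apply: near_eq_cvg.
near=> h.
have h0 : h != 0 by near: h; exact: nbhs_dnbhs_neq.
rewrite /= !mxE eqxx /=.
by rewrite addrK /GRing.scale /= mulrA mulVf// mul1r.
Unshelve. all: by end_near.
Qed.

Lemma is_derive_sum_poly_logistic (p : 'I_n -> {poly R}) a b (i : 'I_n) (x : 'rV[R]_n) :
  is_derive x (delta_mx ord0 i : 'rV[R]_n) (fun y => \sum_j (p j).[s (a + b * y ord0 j)])
    (b *: logisticD_poly (p i)).[s (a + b * x ord0 i)].
Proof.
have h := is_derive_sum (fun j : 'I_n => @is_derive_comp_coord _ _ i j x
  (is_derive_poly_logistic (p j) a b (x ord0 j))).
rewrite (_ : (fun y => _) =
  \sum_j (fun y : 'rV[R]_n => (p j).[s (a + b * y ord0 j)])); last first.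
  by apply/funext => y; rewrite fct_sumE.
apply: (is_derive_eq h).
rewrite (bigD1 i)//= eqxx mulr1n big1 ?addr0// => j /negbTE ->.
by rewrite mulr0n.
Qed.

Lemma continuous_sum_poly_logistic (p : 'I_n -> {poly R}) a b :
  continuous (fun y : 'rV[R]_n => \sum_j (p j).[s (a + b * y ord0 j)]).
Proof.
move=> x; apply: differentiable_continuous.
rewrite (_ : (fun y => _) =
  \sum_j (fun y : 'rV[R]_n => (p j).[s (a + b * y ord0 j)])); last first.
  by apply/funext => y; rewrite fct_sumE.
apply: differentiable_sum => j.
apply: (@differentiable_comp _ _ _ _ (fun y : 'rV[R]_n => y ord0 j)
  (fun z => (p j).[s (a + b * z)])); first exact: differentiable_coord.
apply/derivable1_diffP.
by have [] := is_derive_poly_logistic (p j) a b (x ord0 j).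
Qed.

(** Partial derivatives stay within this class of functions, so induction on the order works once
    [p] is generalised. *)
Lemma smooth_sum_poly_logistic (p : 'I_n -> {poly R}) a b :
  smooth (fun y : 'rV[R]_n => \sum_j (p j).[s (a + b * y ord0 j)]).
Proof.
move=> k; elim: k p => [|k ih] p /=; (split; [exact: continuous_sum_poly_logistic|]) => //.
move=> i; split=> [x|].
  by have [] := is_derive_sum_poly_logistic p a b i x.
(* Only the [i]-th summand survives; zero polynomials elsewhere restore the form of the induction
   hypothesis. *)
rewrite (_ : partial i _ = fun y : 'rV[R]_n =>
    \sum_j ((b *: logisticD_poly (p i)) *+ (j == i)).[s (a + b * y ord0 j)]).
  exact: ih.
apply/funext => x; rewrite /partial.
rewrite (@derive_val _ _ _ _ _ _ _ (is_derive_sum_poly_logistic p a b i x)).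
by rewrite (bigD1 i)//= eqxx mulr1n big1 ?addr0// => j /negbTE ->; rewrite horner0.
Qed.

End smooth.

(** * The logistic density and elementary bounds *)

Section logistic_more.
Context {R : realType}.
Implicit Types u a b : R.
Local Notation s := (@logistic R).

Lemma continuous_logistic : continuous s.
Proof.
move=> x; apply: differentiable_continuous; apply/derivable1_diffP.
by have [] := is_derive_logistic x.
Qed.

Definition logistic_density u : R := s u * (1 - s u).

Lemma logistic_density_ge0 u : 0 <= logistic_density u.
Proof. by rewrite mulr_ge0// ?subr_ge0 ltW// ?logistic_gt0 ?logistic_lt1. Qed.

Lemma logistic_density_le_logistic u : logistic_density u <= s u.
Proof.
by rewrite /logistic_density mulrBr mulr1 lerBlDr lerDl mulr_ge0 // ltW// logistic_gt0.
Qed.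

Lemma logistic_density_le_quarter u : logistic_density u <= 4^-1.
Proof. by rewrite /logistic_density; have := sqr_ge0 (s u - 2^-1); lra. Qed.

Lemma continuous_logistic_density : continuous logistic_density.
Proof.
move=> x; apply: cvgM; first exact: continuous_logistic.
by apply: cvgB; [exact: cvg_cst|exact: continuous_logistic].
Qed.

Lemma measurable_logistic : measurable_fun [set: R] s.
Proof. exact: (continuous_measurable_fun continuous_logistic). Qed.

Lemma measurable_logistic_density : measurable_fun [set: R] logistic_density.
Proof. exact: (continuous_measurable_fun continuous_logistic_density). Qed.

Lemma logistic_densityN u : logistic_density (- u) = logistic_density u.
Proof. by rewrite /logistic_density logisticN; ring. Qed.

(** The identity [expR (- u) * s u = 1 - s u] turns the density into [expR (- u) * s u ^+ 2], and
    [s u >= 1/2]. Exponential tails can thereby be integrated through the density. *)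
Lemma expRN_le_logistic_density u : 0 <= u -> expR (- u) <= 4 * logistic_density u.
Proof.
move=> u0; have h1 := logistic_ge_half u0.
have h2 : (expR (- u) : R) * s u = 1 - s u.
  rewrite /logistic; have : 0 < 1 + expR (- u) by rewrite addr_gt0 ?expR_gt0.
  by move=> /lt0r_neq0 h; field.
have e0 : 0 < expR (- u) by exact: expR_gt0.
rewrite /logistic_density -h2.
have h3 : 2^-1 * 2^-1 <= s u * s u by apply: ler_pM.
nra.
Qed.

(** For [u >= 0] the error is [1 - s u], and [s u >= 1/2] supplies the other factor of the density;
    [u < 0] is symmetric. This is the pointwise smoothing error. *)
Lemma dist_ind_logistic_le u :
  `|(0 <= u)%R%:R - s u| <= 2 * logistic_density u.
Proof.
have h0 := logistic_gt0 u; have h1 := logistic_lt1 u.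
rewrite /logistic_density; case: (leP 0 u) => u0 /=.
  rewrite ger0_norm ?subr_ge0; last exact: ltW.
  by have := logistic_ge_half u0; nra.
rewrite sub0r normrN ger0_norm; last exact: ltW.
have : 0 <= - u by rewrite oppr_ge0 ltW.
by move/logistic_ge_half; rewrite logisticN; nra.
Qed.

End logistic_more.

(** * Means of bounded functions and the Poincare inequality *)

Section bm.
Context {d} {T : measurableType d} {R : realType} (P : probability T R).
Implicit Types f g : T -> R.

(** This class is stable under the operations below and has finite means, so [Rintegral] is linear
    on it and never takes its default value there. *)
Definition bounded_mfun f := measurable_fun setT f /\ exists M, forall w, `|f w| <= M.
Local Notation bm := bounded_mfun.
Local Notation E f := (Rintegral P setT f).

Lemma bounded_mfun_integrable f : bm f -> P.-integrable setT (EFin \o f).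
Proof.
move=> [mf [M hM]]; apply: measurable_bounded_integrable => //.
  by rewrite (le_lt_trans (probability_le1 _ _)) ?ltry.
exists M; split; first exact: num_real.
by move=> x Mx w _; exact: le_trans (hM w) (ltW Mx).
Qed.

Lemma bounded_mfun_cst c : bm (fun=> c).
Proof. by split => //; exists `|c|. Qed.

Lemma bounded_mfunD f g : bm f -> bm g -> bm (fun w => f w + g w).
Proof.
move=> [mf [M hM]] [mg [N hN]]; split; first exact: measurable_funD.
by exists (M + N) => w; rewrite (le_trans (ler_normD _ _))// lerD.
Qed.

Lemma bounded_mfunM f g : bm f -> bm g -> bm (fun w => f w * g w).
Proof.
move=> [mf [M hM]] [mg [N hN]]; split; first exact: measurable_funM.
by exists (M * N) => w; rewrite normrM ler_pM.
Qed.

Lemma bounded_mfunB f g : bm f -> bm g -> bm (fun w => f w - g w).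
Proof.
move=> [mf [M hM]] [mg [N hN]]; split; first exact: measurable_funB.
by exists (M + N) => w; rewrite (le_trans (ler_normB _ _))// lerD.
Qed.

Lemma bounded_mfunX f n : bm f -> bm (fun w => f w ^+ n).
Proof.
move=> [mf [M hM]]; split; first exact: measurable_funX.
by exists (M ^+ n) => w; rewrite normrX lerXn2r ?nnegrE// (le_trans _ (hM w)).
Qed.

Lemma bounded_mfun_norm f : bm f -> bm (fun w => `|f w|).
Proof.
move=> [mf [M hM]]; split; first exact: measurableT_comp.
by exists M => w; rewrite normr_id.
Qed.

Lemma bounded_mfun_sum n (f : 'I_n -> T -> R) :
  (forall i, bm (f i)) -> bm (fun w => \sum_(i < n) f i w).
Proof.
elim: n f => [|n ih] f hf.
  by under eq_fun do rewrite big_ord0; exact: bounded_mfun_cst.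
by under eq_fun do rewrite big_ord_recr/=; apply: bounded_mfunD => //; exact: ih.
Qed.

Lemma bounded_mfun_itv01 f : measurable_fun setT f ->
  (forall w, 0 <= f w <= 1) -> bm f.
Proof.
move=> mf h; split=> //; exists 1 => w.
by have /andP[h0 h1] := h w; rewrite ger0_norm.
Qed.

Lemma mean_cst c : E (fun=> c) = c.
Proof. by rewrite Rintegral_cst// [X in fine X](@probability_setT _ _ _ P) mulr1. Qed.

Lemma meanD f g : bm f -> bm g -> E (fun w => f w + g w) = E f + E g.
Proof. by move=> hf hg; apply: RintegralD => //; exact: bounded_mfun_integrable. Qed.

Lemma meanB f g : bm f -> bm g -> E (fun w => f w - g w) = E f - E g.
Proof. by move=> hf hg; apply: RintegralB => //; exact: bounded_mfun_integrable. Qed.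

Lemma meanZ c f : bm f -> E (fun w => c * f w) = c * E f.
Proof. by move=> hf; apply: RintegralZl => //; exact: bounded_mfun_integrable. Qed.

Lemma mean_sum n (f : 'I_n -> T -> R) : (forall i, bm (f i)) ->
  E (fun w => \sum_(i < n) f i w) = \sum_(i < n) E (f i).
Proof.
elim: n f => [|n ih] f hf.
  by under eq_fun do rewrite big_ord0; rewrite mean_cst big_ord0.
under eq_fun do rewrite big_ord_recr/=.
by rewrite meanD// ?ih// ?big_ord_recr//; exact: bounded_mfun_sum.
Qed.

Lemma le_mean f g : bm f -> bm g -> (forall w, f w <= g w) -> E f <= E g.
Proof. by move=> hf hg fg; apply: le_Rintegral => //; exact: bounded_mfun_integrable. Qed.

Lemma mean_ge0 f : (forall w, 0 <= f w) -> 0 <= E f.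
Proof. by move=> f0; exact: Rintegral_ge0. Qed.

Lemma EFin_mean f : bm f -> (\int[P]_w (f w)%:E)%E = (E f)%:E.
Proof.
move=> /bounded_mfun_integrable h; rewrite /Rintegral fineK//.
exact: integrable_fin_num.
Qed.

Lemma bounded_mfun_logistic (Y : T -> R) a b : measurable_fun setT Y ->
  bm (fun w => logistic (a + b * Y w)).
Proof.
move=> mY; apply: bounded_mfun_itv01 => [|w].
  apply: (measurableT_comp measurable_logistic).
  by apply: measurable_funD => //; exact: measurable_funM.
by rewrite !ltW// ?logistic_gt0 ?logistic_lt1.
Qed.

Lemma bounded_mfun_logistic_density (Y : T -> R) a b : measurable_fun setT Y ->
  bm (fun w => logistic_density (a + b * Y w)).
Proof.
move=> mY; apply: bounded_mfunM; first exact: bounded_mfun_logistic.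
by apply: bounded_mfunB; [exact: bounded_mfun_cst|exact: bounded_mfun_logistic].
Qed.

End bm.

(** * The Poincare inequality for sums of logistic functions *)

Section PI_logistic.
Context {d} {T : measurableType d} {R : realType} (P : probability T R) (n : nat).
Variables (X : {RV P >-> n.-tuple (measurableTypeR R)}) (sigma2 : R).
Local Notation E f := (Rintegral P setT f).
Local Notation Y i w := (tnth (X w) i).

Lemma measurable_coord i : measurable_fun setT (fun w => Y i w : R).
Proof.
exact: (measurableT_comp (@measurable_tnth _ (measurableTypeR R) n i)
  (measurable_funP X)).
Qed.

(** The [i]-th component of the gradient, [c i * b * logistic_density], depends on the [i]-th
    coordinate alone, so the squared gradient is a sum of one-coordinate terms. *)
Lemma variance_sum_logistic_le (c : 'I_n -> R) a b :
  PI (distribution P X) sigma2 ->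
  E (fun w => (\sum_i c i * logistic (a + b * Y i w)) ^+ 2) -
  E (fun w => \sum_i c i * logistic (a + b * Y i w)) ^+ 2 <=
  sigma2 * \sum_i E (fun w => (c i * b * logistic_density (a + b * Y i w)) ^+ 2).
Proof.
pose p i : {poly R} := c i *: 'X.
pose g (y : 'rV[R]_n) := \sum_j (p j).[logistic (a + b * y ord0 j)].
have gE y : g (row_of y) = \sum_i c i * logistic (a + b * tnth y i).
  by apply: eq_bigr => i _; rewrite !hornerE mxE.
have ggE y : grad_sq g (row_of y) =
    \sum_i (c i * b * logistic_density (a + b * tnth y i)) ^+ 2.
  apply: eq_bigr => i _; rewrite /partial.
  rewrite (@derive_val _ _ _ _ _ _ _ (is_derive_sum_poly_logistic p a b i _)).
  rewrite /logisticD_poly derivZ derivX !hornerE mxE /logistic_density.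
  by congr (_ ^+ 2); rewrite /=; ring.
have mY i : measurable_fun setT (fun y : n.-tuple (measurableTypeR R) => tnth y i : R).
  exact: measurable_tnth.
have bmg (d' : measure_display) (T' : measurableType d') (Z : T' -> n.-tuple R) :
    (forall i, measurable_fun setT (fun w => tnth (Z w) i)) ->
  bounded_mfun (fun w => \sum_i c i * logistic (a + b * tnth (Z w) i)).
  move=> mZ; apply: bounded_mfun_sum => i; apply: bounded_mfunM.
    exact: bounded_mfun_cst.
  exact: bounded_mfun_logistic.
(* [Z] is arbitrary because the claim serves both for the identity of the tuple space and for
   [X]. *)
have bmgg (d' : measure_display) (T' : measurableType d') (Z : T' -> n.-tuple R) i :
    (forall i, measurable_fun setT (fun w => tnth (Z w) i)) ->
  bounded_mfun (fun w => (c i * b * logistic_density (a + b * tnth (Z w) i)) ^+ 2).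
  move=> mZ; apply: bounded_mfunX; apply: bounded_mfunM.
    exact: bounded_mfun_cst.
  exact: bounded_mfun_logistic_density.
move=> /(_ g (smooth_sum_poly_logistic p a b)).
(* The inequality is stated under the law of [X]; a change of variables moves each integral to
   [T]. *)
have push f : @bounded_mfun _ (n.-tuple (measurableTypeR R)) R f ->
    (\int[distribution P X]_y (f y)%:E)%E = (E (fun w => f (X w)))%:E.
  move=> [mf [M hM]].
  have bf : bounded_mfun (fun w => f (X w)).
    split; first exact: measurableT_comp.
    by exists M => w.
  rewrite integral_distribution.
  - by rewrite -EFin_mean.
  - exact/measurable_EFinP.
  - exact: (bounded_mfun_integrable P bf).
under [X in (X - _ <= _)%E]eq_integral do rewrite gE.
under [X in (_ - X ^+ 2 <= _)%E]eq_integral do rewrite gE.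
under [X in (_ <= _ * X)%E]eq_integral do rewrite ggE.
rewrite !push.
- rewrite -EFin_expe -EFinB -EFinM lee_fin.
  have <- := mean_sum P (fun i => bmgg _ _ (fun w => X w) i measurable_coord).
  apply.
  (* [PI] asks for a bounded [g]; this bound works because [0 < s < 1]. *)
  exists (\sum_i `|c i|); split; first exact: num_real.
  move=> M hM y _; apply: le_trans (ltW hM); apply: le_trans (ler_norm_sum _ _ _) _.
  apply: ler_sum => i _; rewrite !hornerE normrM ler_piMr//.
  by rewrite ger0_norm ltW// ?logistic_gt0 ?logistic_lt1.
- by apply: bounded_mfun_sum => i; exact: (bmgg _ _ id i).
- exact: (bmg _ _ id).
- by apply: bounded_mfunX; exact: (bmg _ _ id).
Qed.

End PI_logistic.

(** * Integrals of the logistic density *)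

Section integral_logistic_density.
Context {R : realType}.
Local Notation mu := (@lebesgue_measure R).
Local Notation s := (@logistic R).
Local Notation k := (@logistic_density R).

Lemma cvgy_logistic : s x @[x --> +oo] --> (1 : R).
Proof.
have h : (1 + expR (- x) : R) @[x --> +oo] --> (1 : R).
  rewrite -[X in _ --> X]addr0; apply: cvgD; first exact: cvg_cst.
  exact: cvgr_expR.
by rewrite -[X in _ --> X]invr1; apply: cvgV => //; exact: oner_neq0.
Qed.

(** [s] is a primitive, with value 1/2 at 0 and limit 1 at infinity. *)
Lemma integral_logistic_density_ge0 :
  (\int[mu]_(x in `[0%R, +oo[) (k x)%:E = (2^-1)%:E)%E.
Proof.
rewrite (@ge0_continuous_FTC2y _ _ s 0 1).
- by rewrite /logistic oppr0 expR0 -EFinB; congr (_%:E); field.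
- by move=> x _; exact: logistic_density_ge0.
- by apply: continuous_subspaceT; exact: continuous_logistic_density.
- exact: cvgy_logistic.
- by move=> x _; have [] := is_derive_logistic x.
- exact: (cvg_at_right_filter (@continuous_logistic R 0)).
- move=> x _; rewrite derive1E.
  by rewrite (@derive_val _ _ _ _ _ _ _ (is_derive_logistic x)).
Qed.

Lemma integral_logistic_density : (\int[mu]_x (k x)%:E = 1)%E.
Proof.
rewrite ge0_symfun_integralT.
- by rewrite -set_itvcy integral_logistic_density_ge0 -EFinM mulfV.
- exact: logistic_density_ge0.
- exact: continuous_logistic_density.
- by move=> x /=; rewrite logistic_densityN.
Qed.

Lemma measurable_affine_logistic_density a b :
  measurable_fun [set: R] (fun x => k (a + b * x)).
Proof.
apply: (measurableT_comp measurable_logistic_density).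
by apply: measurable_funD => //; exact: measurable_funM.
Qed.

(** Substitution along the affine map [F], of constant slope [h^-1], reduces this to total mass
    1. *)
Lemma integral_affine_logistic_density (a h : R) : 0 < h ->
  (\int[mu]_x (k (a + h^-1 * x))%:E = h%:E)%E.
Proof.
move=> h0.
pose F (x : R) := a + h^-1 * x.
have dF x : is_derive x (1:R) F h^-1.
  by rewrite /F; apply: is_derive_eq; rewrite /GRing.scale /= add0r mul1r mulr1.
have F'E : derive1 F = cst h^-1.
  apply/funext => x; rewrite derive1E.
  by rewrite (@derive_val _ _ _ _ _ _ _ (dF x)).
have hi0 : 0 < h^-1 by rewrite invr_gt0.
have : (1 = \int[mu]_x (((k \o F) * derive1 F) x)%:E)%E.
  rewrite -integral_logistic_density.
  apply: increasing_ge0_integration_by_substitutionT; rewrite ?F'E.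
- by move=> x y xy; rewrite /F ltrD2l ltr_pM2l.
- exact: cst_continuous.
- exact: is_cvg_cst.
- exact: is_cvg_cst.
- by move=> x; have [] := dF x.
- apply/cvgrNyPle => A; near=> x.
  have xA : x <= h * (A - a) by near: x; apply: nbhs_ninfty_le; exact: num_real.
  by rewrite /F -lerBrDl mulrC ler_pdivrMr// mulrC.
- apply/cvgryPge => A; near=> x.
  have xA : h * (A - a) <= x by near: x; apply: nbhs_pinfty_ge; exact: num_real.
  by rewrite /F -lerBlDl mulrC ler_pdivlMr// mulrC.
- exact: continuous_logistic_density.
- exact: logistic_density_ge0.
rewrite F'E /= => e.
have : (\int[mu]_x (h^-1%:E * (k (F x))%:E) = 1)%E.
  by rewrite [RHS]e; apply: eq_integral => x _; rewrite -EFinM mulrC.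
rewrite ge0_integralZl//.
- move=> /(congr1 (fun z => h%:E * z)%E).
  by rewrite muleA -EFinM mulfV ?gt_eqF// mul1e mule1.
- by apply/measurable_EFinP; exact: measurable_affine_logistic_density.
- by move=> x _; rewrite lee_fin logistic_density_ge0.
- by rewrite lee_fin ltW.
Unshelve. all: by end_near. Qed.

End integral_logistic_density.

(** * Tail estimates *)

Section tail.
Context {d} {T : measurableType d} {R : realType} (P : probability T R).
Variables (Y : T -> R) (b : R).
Hypothesis mY : measurable_fun setT Y.
Local Notation E f := (Rintegral P setT f).
Local Notation s := (@logistic R).

Lemma bounded_mfun_ltr (f g : T -> R) : measurable_fun setT f -> measurable_fun setT g ->
  bounded_mfun (fun w => ((f w < g w)%R%:R : R)).
Proof.
move=> mf mg; apply: bounded_mfun_itv01 => [|w]; last by rewrite ler0n lern1 leq_b1.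
apply: (measurableT_comp (f := fun c : bool => (c%:R : R))) => //.
exact: measurable_fun_ltr.
Qed.

Lemma bounded_mfun_ler (f g : T -> R) : measurable_fun setT f -> measurable_fun setT g ->
  bounded_mfun (fun w => ((f w <= g w)%R%:R : R)).
Proof.
move=> mf mg; apply: bounded_mfun_itv01 => [|w]; last by rewrite ler0n lern1 leq_b1.
apply: (measurableT_comp (f := fun c : bool => (c%:R : R))) => //.
exact: measurable_fun_ler.
Qed.

(* The hypotheses are the Poincare inequality for g = s (a + b Y), after
   (b sigma)^2 = 1/4 and |s'| <= s, and the fact that m is at least a median of
   b Y.  The bound splits g at the level set {m < b Y}: below it g <= exp(a + m),
   above it AM-GM absorbs g into 49/60 E g. *)
Lemma logistic_tail m a :
  E (fun w => s (a + b * Y w) ^+ 2) - E (fun w => s (a + b * Y w)) ^+ 2 <=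
    4^-1 * E (fun w => s (a + b * Y w) ^+ 2) ->
  E (fun w => (m < b * Y w)%R%:R) <= 2^-1 ->
  E (fun w => s (a + b * Y w)) <= 6 * expR (a + m).
Proof.
set g := fun w => s (a + b * Y w); set I : T -> R := (fun w => (m < b * Y w)%R%:R) => hvar hI.
have bg : bounded_mfun g by exact: bounded_mfun_logistic.
have bI : bounded_mfun I.
  by apply: (bounded_mfun_ltr (f := fun=> m)) => //; exact: measurable_funM.
pose M := E g.
have M0 : 0 <= M by apply: mean_ge0 => w; rewrite ltW// logistic_gt0.
have g0 w : 0 < g w by exact: logistic_gt0.
have h1 : M <= expR (a + m) + E (fun w => g w * I w).
  rewrite -(mean_cst P (expR (a + m))) -meanD//; last 2 first.
  - exact: bounded_mfun_cst.
  - exact: bounded_mfunM.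
  apply: le_mean => //.
    by apply: bounded_mfunD; [exact: bounded_mfun_cst|exact: bounded_mfunM].
  move=> w; rewrite /I; case: ltP => h /=.
    by rewrite mulr1 lerDr expR_ge0.
  by rewrite mulr0 addr0 (le_trans (logistic_le_expR _))// ler_expR lerD2l.
(* AM-GM in the form [M g <= 3/10 g^2 + 5/6 M^2], from [(3 g - 5 M)^2 >= 0]. *)
have h2 : M * E (fun w => g w * I w) <=
    10^-1 * 3 * E (fun w => g w ^+ 2) + (5 / 6 * M ^+ 2) * E I.
  have bgI := bounded_mfunM bg bI; have bg2 := bounded_mfunX 2 bg.
  have b1 := bounded_mfunM (bounded_mfun_cst (10^-1 * 3 : R)) bg2.
  have b2 := bounded_mfunM (bounded_mfun_cst (5 / 6 * M ^+ 2)) bI.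
  have b3 := bounded_mfunM (bounded_mfun_cst M) bgI.
  rewrite -(meanZ P _ bgI) -(meanZ P _ bg2) -(meanZ P _ bI) -(meanD P b1 b2).
  apply: le_mean => //; first exact: bounded_mfunD.
  move=> w; rewrite /I; case: ltP => h /=; rewrite ?mulr1 ?mulr0 ?addr0.
    by have := sqr_ge0 (3 * g w - 5 * M); nra.
  by rewrite mulr_ge0// sqr_ge0.
rewrite -/M in hvar *.
have e0 := expR_gt0 (a + m).
have I0 : 0 <= E I by apply: mean_ge0 => w; exact: ler0n.
have [->|Mn0] := eqVneq M 0; first by rewrite mulr_ge0// ltW.
have Mp : 0 < M by rewrite lt_neqAle eq_sym Mn0.
(* The variance hypothesis reads [E g^2 <= 4/3 M^2], and [3/10 * 4/3 + 5/6 * 1/2 = 49/60]. *)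
have h3 : M * E (fun w => g w * I w) <= M * (49 / 60 * M).
  apply: (le_trans h2); have hM2 : (5 / 6 * M ^+ 2) * E I <= (5 / 6 * M ^+ 2) * 2^-1.
    by rewrite ler_wpM2l// mulr_ge0// sqr_ge0.
  move: hvar hM2; rewrite /g /=; set V := E _; nra.
rewrite ler_pM2l// in h3.
(* [M <= expR (a + m) + 49/60 M] gives the factor [60/11 <= 6]. *)
lra.
Qed.

End tail.

(** * Approximate medians, and the distance from a point to the mean *)

Section median.
Context {d} {T : measurableType d} {R : realType} (P : probability T R).
Variables (Y : T -> R).
Hypothesis mY : measurable_fun setT Y.
Local Notation E f := (Rintegral P setT f).

Lemma EFin_mean_ind (p : T -> bool) : measurable [set w | p w] ->
  (E (fun w => (p w)%:R))%:E = P [set w | p w].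
Proof.
move=> mp.
have -> : (fun w => (p w)%:R) = \1_[set w | p w] :> (T -> R).
  by apply/funext => w; rewrite indicE; congr ((nat_of_bool _)%:R); apply/idP/idP; rewrite inE.
rewrite -EFin_mean; first by rewrite integral_indic// setIT.
apply: bounded_mfun_itv01; first exact: measurable_indic.
by move=> w; rewrite indicE ler0n lern1 leq_b1.
Qed.

(** [m] is chosen among the points where the distribution function is at least 1/2, within [e] of
    their infimum, so that [m - e] falls below that infimum. *)
Lemma exists_median (e : R) : 0 < e -> exists m,
  E (fun w => (m < Y w)%R%:R) <= 2^-1 /\ E (fun w => (Y w < m - e)%R%:R) <= 2^-1.
Proof.
move=> e0.
pose Y' : {RV P >-> R} := mfun_Sub (mem_set mY : Y \in mfun).
pose F x := E (fun w => (Y w <= x)%R%:R).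
have bF x : bounded_mfun (fun w => ((Y w <= x)%R%:R : R)).
  exact: (bounded_mfun_ler (g := fun=> x)).
have FE x : cdf Y' x = (F x)%:E.
  rewrite /F EFin_mean_ind; last first.
    rewrite -[X in measurable X]setTI.
    exact: (measurable_fun_ler mY (measurable_cst x) measurableT (Y := [set true])).
  by rewrite /cdf /distribution /pushforward; congr (P _); apply/seteqP; split => w;
    rewrite /= in_itv.
have Fnd x y : x <= y -> F x <= F y.
  move=> xy; apply: le_mean => // w.
  rewrite ler_nat; case: (leP (Y w) x) => //= h; by rewrite (le_trans h xy).
(* The limits 1 and 0 of the distribution function at the two ends will make the set [S] nonempty
   and bounded below. *)
have [x0 hx0] : exists x, 2^-1 <= F x.
  have /fine_cvgP[_ h] := cvg_cdfy1 Y'.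
  have {}h := cvgr_gt _ h (2^-1) ltac:(lra).
  have [x hx] := filter_ex h.
  by exists x; rewrite ltW//; move: hx; rewrite /= FE.
have [x1 hx1] : exists x, F x < 2^-1.
  have /fine_cvgP[_ h] := cvg_cdfNy0 Y'.
  have {}h := cvgr_lt _ h (2^-1) ltac:(lra).
  have [x hx] := filter_ex h.
  by exists x; move: hx; rewrite /= FE.
pose S := [set x | 2^-1 <= F x].
have hS : has_inf S.
  split; first by exists x0.
  exists x1 => x; rewrite /S /= => Sx; rewrite leNgt; apply/negP => /ltW /Fnd Fx; lra.
have [m Sm hm] := inf_adherent e0 hS.
exists m; split.
  rewrite (_ : (fun w => _) = fun w => 1 - (Y w <= m)%R%:R :> R).
    rewrite meanB ?mean_cst//; last exact: bounded_mfun_cst.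
    rewrite -/(F m); move: Sm; rewrite /S /= => Fm; lra.
  by apply/funext => w; rewrite leNgt; case: (m < _)%R; rewrite ?subr0 ?subrr.
have : ~ S (m - e).
  move=> /(ge_inf hS.2) mS; lra.
rewrite /S /= => /negP; rewrite -ltNge => /ltW; apply: le_trans.
apply: le_mean => //; first exact: (bounded_mfun_ltr (g := fun=> m - e)).
by move=> w; rewrite ler_nat; case: ltP => //= /ltW ->.
Qed.

(** The mean of [l |Y - m|] is the integral of its tail. Since [B expR (- r) <= 4 B k(r)] and the
    logistic density [k] has mass 1/2 on the half-line, that mean is at most [2 B]. *)
Lemma mean_deviation_le (m l B : R) : 0 < l ->
  (forall r, 0 <= r -> E (fun w => (r < l * `|Y w - m|)%R%:R) <= B * expR (- r)) ->
  `|fine (\int[P]_w (Y w)%:E) - m| <= 2 * B / l.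
Proof.
move=> l0 hB.
pose V w := l * `|Y w - m|.
have mV : measurable_fun setT V.
  apply: measurable_funM => //; apply: measurableT_comp => //.
  exact: measurable_funB.
have V0 w : 0 <= V w by rewrite mulr_ge0// ltW.
pose V' : {RV P >-> R} := mfun_Sub (mem_set mV : V \in mfun).
have B0 : 0 <= B.
  by have := hB 0 (lexx _); rewrite oppr0 expR0 mulr1; apply: le_trans; apply: mean_ge0 => w.
have iV : (\int[P]_w (V w)%:E <= (2 * B)%:E)%E.
  have -> : (\int[P]_w (V w)%:E = 'E_P[V'])%E by rewrite unlock.
  rewrite ge0_expectation_ccdf//.
  have -> : (2 * B)%:E = ((4 * B)%:E * (2^-1)%:E)%E by rewrite -EFinM; congr (_%:E); field.
  rewrite -integral_logistic_density_ge0 -ge0_integralZl//; last 3 first.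
  - by apply/measurable_EFinP; apply: measurable_funTS; exact: measurable_logistic_density.
  - by move=> x _; rewrite lee_fin logistic_density_ge0.
  - by rewrite lee_fin mulr_ge0.
  apply: ge0_le_integral => //.
  - by apply: measurable_funTS; exact: ccdf_measurable.
  - apply/measurable_EFinP; apply: measurable_funTS; apply: measurable_funM => //.
    exact: measurable_logistic_density.
  move=> r /=; rewrite in_itv/= andbT => r0.
  have -> : ccdf V' r = (E (fun w => (r < V w)%R%:R))%:E.
    rewrite EFin_mean_ind; last first.
      rewrite -[X in measurable X]setTI.
      exact: (measurable_fun_ltr (measurable_cst r) mV measurableT (Y := [set true])).
    by rewrite /ccdf /distribution /pushforward; congr (P _); apply/seteqP; split => w;
      rewrite /= in_itv/= andbT.
  rewrite lee_fin (le_trans (hB r r0))//.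
  by rewrite -mulrA mulrCA ler_wpM2l// expRN_le_logistic_density.
(* The finite mean of [V] makes [Y - m] integrable, which justifies splitting off [m]. *)
have iYm : P.-integrable setT (fun w => (Y w - m)%:E).
  apply/integrableP; split.
    by apply/measurable_EFinP; exact: measurable_funB.
  have h : (\int[P]_w (l^-1%:E * (V w)%:E) < +oo)%E.
    rewrite ge0_integralZl//.
    - apply: (@le_lt_trans _ _ (l^-1%:E * (2 * B)%:E)%E); last by rewrite -EFinM ltry.
      by rewrite lee_wpmul2l// lee_fin invr_ge0 ltW.
    - exact/measurable_EFinP.
    - by move=> w _; rewrite lee_fin.
    - by rewrite lee_fin invr_ge0 ltW.
  apply: le_lt_trans h; rewrite le_eqVlt; apply/orP; left; apply/eqP.
  apply: eq_integral => w _; rewrite -EFinM /V mulKf ?gt_eqF//.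
have iYE : (\int[P]_w (Y w)%:E = \int[P]_w (Y w - m)%:E + m%:E)%E.
  have -> : m%:E = (\int[P]_w (cst m%:E) w)%E.
    by rewrite integral_cst// [X in (_ * X)%E](@probability_setT _ _ _ P) mule1.
  rewrite -integralD//; last exact: (bounded_mfun_integrable P (bounded_mfun_cst m)).
  by apply: eq_integral => w _; rewrite -EFinD subrK.
rewrite iYE fineD//; last exact: (integrable_fin_num _ iYm).
rewrite /= addrK.
have := @le_normr_Rintegral _ _ _ P setT (fun w => Y w - m) measurableT iYm.
rewrite /Rintegral => /le_trans; apply.
have : (\int[P]_w (V w)%:E = l%:E * \int[P]_w `|Y w - m|%:E)%E.
  rewrite -ge0_integralZl//.
  - apply/measurable_EFinP; apply: measurableT_comp => //; exact: measurable_funB.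
  - by rewrite lee_fin ltW.
have ifin : (\int[P]_w `|Y w - m|%:E)%E \is a fin_num.
  exact: (integrable_fin_num _ (integrable_norm iYm)).
move: iV => /[swap] ->; rewrite -(fineK ifin) -EFinM lee_fin.
by rewrite ler_pdivlMr// mulrC.
Qed.

End median.

(** * Exponential tails of one coordinate *)

Section coordinate_tail.
Context {d} {T : measurableType d} {R : realType} (P : probability T R) (n : nat).
Variables (X : {RV P >-> n.-tuple (measurableTypeR R)}) (sigma : R).
Hypotheses (sigma_gt0 : 0 < sigma) (PIX : PI (distribution P X) (sigma ^+ 2)).
Local Notation E f := (Rintegral P setT f).
Local Notation Y i w := (tnth (X w) i).
Local Notation s := (@logistic R).
Local Notation k := (@logistic_density R).

(** [|s'| <= s] replaces the gradient by the function itself; with [(sigma * b) ^+ 2 = 1/4] this is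
    the variance hypothesis of [logistic_tail]. *)
Lemma variance_logistic_le (i : 'I_n) a b :
  E (fun w => s (a + b * Y i w) ^+ 2) - E (fun w => s (a + b * Y i w)) ^+ 2 <=
  (sigma * b) ^+ 2 * E (fun w => s (a + b * Y i w) ^+ 2).
Proof.
have mY := measurable_coord X i.
(* These coefficients select the coordinate [i]. *)
have := variance_sum_logistic_le (fun j => (j == i)%:R) a b PIX.
have sE w : \sum_j (j == i)%:R * s (a + b * Y j w) = s (a + b * Y i w).
  by rewrite (bigD1 i)//= eqxx mul1r big1 ?addr0// => j /negbTE ->; rewrite mul0r.
under eq_fun do rewrite sE.
under [in X in _ - X ^+ 2]eq_fun do rewrite sE.
move=> /le_trans; apply.
rewrite (bigD1 i)//= big1 => [|j /negbTE ->]; last first.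
  under eq_fun do rewrite mul0r mul0r expr0n.
  by rewrite mean_cst.
rewrite addr0 eqxx exprMn -[leRHS]mulrA ler_wpM2l ?sqr_ge0//.
have bs := bounded_mfun_logistic a b mY.
rewrite -meanZ; last exact: bounded_mfunX.
have bk := bounded_mfun_logistic_density a b mY.
apply: le_mean.
- by apply: bounded_mfunX; apply: bounded_mfunM => //; exact: bounded_mfun_cst.
- by apply: bounded_mfunM; [exact: bounded_mfun_cst|exact: bounded_mfunX].
move=> w; rewrite mul1r exprMn ler_wpM2l ?sqr_ge0// ler_sqr ?nnegrE.
- exact: logistic_density_le_logistic.
- exact: logistic_density_ge0.
- by rewrite ltW// logistic_gt0.
Qed.

(* The factor expR (8 * _) is the cost of replacing the median by the mean. *)
Definition tail_cst : R := 6 * expR 1 * expR (8 * (6 * expR 1)).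

(** This rate makes [(sigma * l) ^+ 2] equal to 1/4. *)
Let l := (2 * sigma)^-1.

Let l_gt0 : 0 < l. Proof. by rewrite invr_gt0 mulr_gt0. Qed.

(** [logistic_tail] is applied with slopes [l] and [- l]. The slack [2 * sigma = l^-1] of the median
    costs a factor [expR 1] in the second bound; the first is weakened to match. *)
Let median_tail (i : 'I_n) : exists m, forall a,
  E (fun w => s (a + l * Y i w)) <= 6 * expR 1 * expR (a + l * m) /\
  E (fun w => s (a + - l * Y i w)) <= 6 * expR 1 * expR (a + - l * m).
Proof.
have s2 : 0 < 2 * sigma by rewrite mulr_gt0.
have [m [hm1 hm2]] := exists_median P (measurable_coord X i) s2.
exists m => a.
have b1 : (sigma * l) ^+ 2 = 4^-1 by rewrite /l; field; rewrite gt_eqF.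
have b2 : (sigma * - l) ^+ 2 = 4^-1 by rewrite mulrN sqrrN.
have e1 : 1 <= expR 1 :> R by rewrite -expR0 ler_expR.
split.
- have : E (fun w => s (a + l * Y i w)) <= 6 * expR (a + l * m).
    apply: logistic_tail; first exact: measurable_coord.
      by rewrite -b1; exact: variance_logistic_le.
    by under eq_fun do rewrite ltr_pM2l//.
  move=> /le_trans; apply; rewrite ler_wpM2r ?expR_ge0//; lra.
- rewrite -mulrA -expRD.
  rewrite (_ : 1 + _ = a + - l * (m - 2 * sigma)); last by rewrite /l; field; rewrite gt_eqF.
  apply: logistic_tail; first exact: measurable_coord.
    by rewrite -b2; exact: variance_logistic_le.
  by under eq_fun do rewrite ltr_nM2l ?oppr_lt0//.
Qed.

(** The tails around the approximate median [m] bound its distance to the mean by a multiple of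
    [l^-1]; moving the centre to the mean then costs a constant factor. *)
Lemma coordinate_tail (i : 'I_n) x :
  E (fun w => s (- (l * x) + l * Y i w)) <= tail_cst * expR (l * (mean_coord X i - x)) /\
  E (fun w => s (l * x + - l * Y i w)) <= tail_cst * expR (l * (x - mean_coord X i)).
Proof.
have [m hm] := median_tail i.
have mY := measurable_coord X i.
set B := 6 * expR 1 in hm.
have B0 : 0 <= B by rewrite mulr_ge0// expR_ge0.
have : l * `|mean_coord X i - m| <= 8 * B.
  (* On the event [r < l |Y - m|] one of two logistic functions is at least 1/2; each has mean at
     most [B expR (- r)], hence the coefficient [2 * (B + B) = 4 * B]. *)
  have : `|mean_coord X i - m| <= 2 * (4 * B) / l.
    rewrite /mean_coord unlock; apply: mean_deviation_le => // r r0.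
    have [u1 _] := hm (- (l * m) - r); have [_ u2] := hm (l * m - r).
    have e1 : - (l * m) - r + l * m = - r by ring.
    have e2 : l * m - r + - l * m = - r by ring.
    rewrite e1 in u1; rewrite e2 in u2.
    have bs1 := bounded_mfun_logistic (- (l * m) - r) l mY.
    have bs2 := bounded_mfun_logistic (l * m - r) (- l) mY.
    apply: (@le_trans _ _ (2 * E (fun w => s (- (l * m) - r + l * Y i w)) +
      2 * E (fun w => s (l * m - r + - l * Y i w)))); last by nra.
    have bz1 := bounded_mfunM (bounded_mfun_cst (2:R)) bs1.
    have bz2 := bounded_mfunM (bounded_mfun_cst (2:R)) bs2.
    rewrite -(meanZ P _ bs1) -(meanZ P _ bs2) -(meanD P bz1 bz2).
    apply: le_mean.
    - apply: (bounded_mfun_ltr (f := fun=> r)) => //.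
      apply: measurable_funM => //; apply: measurableT_comp => //.
      exact: measurable_funB.
    - exact: bounded_mfunD.
    move=> w; case: ltP => [h|_] /=; last first.
      by rewrite addr_ge0// mulr_ge0// ltW// logistic_gt0.
    have p1 := logistic_gt0 (- (l * m) - r + l * Y i w).
    have p2 := logistic_gt0 (l * m - r + - l * Y i w).
    case: (leP 0 (Y i w - m)) => hY.
      rewrite ger0_norm// in h.
      have : 0 <= - (l * m) - r + l * Y i w by lra.
      by move=> /logistic_ge_half; lra.
    rewrite ltr0_norm// in h.
    have : 0 <= l * m - r + - l * Y i w by lra.
    by move=> /logistic_ge_half; lra.
  by rewrite ler_pdivlMr// mulrC => /le_trans; apply; lra.
move=> hmu.
have key (u v : R) : u <= v + 8 * B -> B * expR u <= tail_cst * expR v.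
  move=> uv; rewrite /tail_cst -/B -mulrA ler_wpM2l// -expRD ler_expR; lra.
have [h1 _] := hm (- (l * x)); have [_ h2] := hm (l * x).
split.
- apply: (le_trans h1); apply: key.
  have := ler_wpM2l (ltW l_gt0) (ler_norm (m - mean_coord X i)); rewrite distrC; lra.
- apply: (le_trans h2); apply: key.
  have := ler_wpM2l (ltW l_gt0) (ler_norm (mean_coord X i - m)); lra.
Qed.

End coordinate_tail.

(** * Pointwise estimates of the mean deviation *)

Section pointwise.
Context {d} {T : measurableType d} {R : realType} (P : probability T R) (n : nat).
Variables (X : {RV P >-> n.-tuple (measurableTypeR R)}).
Local Notation E f := (Rintegral P setT f).
Local Notation Y i w := (tnth (X w) i).
Local Notation s := (@logistic R).
Local Notation k := (@logistic_density R).

Lemma edfE (v : n.-tuple R) x :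
  edf v x = \sum_(i < n) n%:R^-1 * (tnth v i <= x)%R%:R.
Proof.
rewrite /edf -sum1_card natr_sum mulr_sumr big_mkcond/=.
by apply: eq_bigr => i _; rewrite inE; case: (_ <= _)%R; rewrite ?mulr0.
Qed.

Lemma edf_ge0 (v : n.-tuple R) x : 0 <= edf v x.
Proof. by rewrite /edf mulr_ge0// invr_ge0. Qed.

Lemma edf_le1 (v : n.-tuple R) x : edf v x <= 1.
Proof.
case: (posnP n) v => [n0 v|n0 v]; first by rewrite /edf {1}n0 invr0 mul0r.
by rewrite /edf ler_pdivrMl ?ltr0n// mulr1 ler_nat (leq_trans (max_card _))// card_ord.
Qed.

Let bY i x : bounded_mfun (fun w => ((Y i w <= x)%R%:R : R)).
Proof. by apply: (bounded_mfun_ler (g := fun=> x)) => //; exact: measurable_coord. Qed.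

Lemma bounded_mfun_edf x : bounded_mfun (fun w => edf (X w) x).
Proof.
under eq_fun do rewrite edfE.
by apply: bounded_mfun_sum => i; apply: bounded_mfunM => //; exact: bounded_mfun_cst.
Qed.

Lemma mean_dfE x : mean_df X x = E (fun w => edf (X w) x).
Proof. by rewrite /mean_df unlock. Qed.

Lemma dist_mean_le (f : T -> R) : bounded_mfun f -> `|E f| <= E (fun w => `|f w|).
Proof.
by move=> bf; apply: le_normr_Rintegral => //; exact: bounded_mfun_integrable.
Qed.

Let G x := E (fun w => `|edf (X w) x - mean_df X x|).

Let bG x : bounded_mfun (fun w => `|edf (X w) x - mean_df X x|).
Proof.
apply: bounded_mfun_norm; apply: bounded_mfunB; first exact: bounded_mfun_edf.
exact: bounded_mfun_cst.
Qed.

(** The argument [(x - X_i) / h] is written in the form [a + b * X_i] of the logistic lemmas. *)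
Definition mean_kernel h x : R :=
  n%:R^-1 * \sum_(i < n) E (fun w => k (h^-1 * x + - h^-1 * Y i w)).

(* The term 4 D(x) is the smoothing error, counted for F_n and for its mean; the
   rest is AM-GM applied to the deviation of the smoothed function. *)
Lemma mean_dist_edf_bulk sigma h th x : (0 < n)%N -> 0 < h -> 0 < th ->
  PI (distribution P X) (sigma ^+ 2) ->
  G x <= (4 + sigma ^+ 2 / (8 * n%:R * h ^+ 2 * th)) * mean_kernel h x + th / 2.
Proof.
move=> n0 h0 th0 PIX.
have mY i := measurable_coord X i.
have bk i := bounded_mfun_logistic_density (h^-1 * x) (- h^-1) (mY i).
have bs i := bounded_mfun_logistic (h^-1 * x) (- h^-1) (mY i).
(* [W] is the empirical distribution function smoothed at scale [h]. *)
pose W w := \sum_i n%:R^-1 * s (h^-1 * x + - h^-1 * Y i w).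
have bW : bounded_mfun W.
  by apply: bounded_mfun_sum => i; apply: bounded_mfunM => //; exact: bounded_mfun_cst.
pose Z w := edf (X w) x.
have bZ : bounded_mfun Z by exact: bounded_mfun_edf.
have bZW : bounded_mfun (fun w => `|Z w - W w|).
  by apply: bounded_mfun_norm; exact: bounded_mfunB.
have bW' : bounded_mfun (fun w => W w - E W).
  by apply: bounded_mfunB => //; exact: bounded_mfun_cst.
have hZW : E (fun w => `|Z w - W w|) <= 2 * mean_kernel h x.
  rewrite /mean_kernel mulrA -mean_sum// -meanZ; last exact: bounded_mfun_sum.
  apply: le_mean => //.
    by apply: bounded_mfunM; [exact: bounded_mfun_cst|exact: bounded_mfun_sum].
  move=> w; rewrite /Z /W edfE -sumrB (le_trans (ler_norm_sum _ _ _))// mulr_sumr.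
  apply: ler_sum => i _; rewrite -mulrBr normrM ger0_norm ?invr_ge0//.
  rewrite [2 * _]mulrC -mulrA ler_wpM2l ?invr_ge0//.
  apply: le_trans (dist_ind_logistic_le _).
  rewrite mulNr subr_ge0 ler_pM2l ?invr_gt0//.
have hW : E (fun w => `|W w - E W|) <=
    th / 2 + sigma ^+ 2 / (8 * n%:R * h ^+ 2 * th) * mean_kernel h x.
  (* The Poincare inequality with [c i = n^-1] and [b = - h^-1]; the bound [k <= 1/4] turns [k ^+ 2]
     into [k / 4]. *)
  have hV : E (fun w => (W w - E W) ^+ 2) <= sigma ^+ 2 / (4 * n%:R * h ^+ 2) * mean_kernel h x.
    have -> : E (fun w => (W w - E W) ^+ 2) = E (fun w => W w ^+ 2) - E W ^+ 2.
      have -> : (fun w => (W w - E W) ^+ 2) =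
          (fun w => W w ^+ 2 + ((- 2 * E W) * W w + E W ^+ 2)).
        by apply/funext => w; ring.
      have b2 := bounded_mfunX 2 bW.
      have b1 := bounded_mfunM (bounded_mfun_cst (- 2 * E W)) bW.
      have b0 := bounded_mfun_cst (T := T) (E W ^+ 2).
      rewrite (meanD P b2 (bounded_mfunD b1 b0)) (meanD P b1 b0) (meanZ P _ bW) mean_cst.
      ring.
    apply: (le_trans (variance_sum_logistic_le (fun=> n%:R^-1) _ _ PIX)).
    rewrite /mean_kernel mulrA mulr_sumr mulr_sumr; apply: ler_sum => i _.
    have bq := bounded_mfunX 2 (bounded_mfunM (bounded_mfun_cst (n%:R^-1 * - h^-1)) (bk i)).
    rewrite -(meanZ P _ bq) -(meanZ P _ (bk i)).
    apply: le_mean.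
    - apply: bounded_mfunM; first exact: bounded_mfun_cst.
      by apply: bounded_mfunX; apply: bounded_mfunM => //; exact: bounded_mfun_cst.
    - by apply: bounded_mfunM => //; exact: bounded_mfun_cst.
    move=> w; set K := k _.
    have K0 : 0 <= K by exact: logistic_density_ge0.
    have K4 : K <= 4^-1 by exact: logistic_density_le_quarter.
    have -> : sigma ^+ 2 * (n%:R^-1 * - h^-1 * K) ^+ 2 =
        (sigma ^+ 2 * n%:R^-1 ^+ 2 * h^-1 ^+ 2) * (K * K) by ring.
    have -> : sigma ^+ 2 / (4 * n%:R * h ^+ 2) / n%:R * K =
        (sigma ^+ 2 * n%:R^-1 ^+ 2 * h^-1 ^+ 2) * (4^-1 * K).
      by field; rewrite !gt_eqF// ltr0n.
    apply: ler_wpM2l; last exact: ler_wpM2r.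
    by apply: mulr_ge0; [apply: mulr_ge0|]; exact: sqr_ge0.
  have hth : (2 * th)^-1 * E (fun w => (W w - E W) ^+ 2) <=
     sigma ^+ 2 / (8 * n%:R * h ^+ 2 * th) * mean_kernel h x.
    have -> : sigma ^+ 2 / (8 * n%:R * h ^+ 2 * th) * mean_kernel h x =
       (2 * th)^-1 * (sigma ^+ 2 / (4 * n%:R * h ^+ 2) * mean_kernel h x).
      by field; rewrite !gt_eqF// ltr0n.
    by rewrite ler_wpM2l// invr_ge0 mulr_ge0// ltW.
  apply: (@le_trans _ _ (th / 2 + (2 * th)^-1 * E (fun w => (W w - E W) ^+ 2)));
    last by rewrite lerD2l.
  rewrite -meanZ; last exact: bounded_mfunX.
  rewrite -{1}(mean_cst P (th / 2)) -meanD; last 2 first.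
  - exact: bounded_mfun_cst.
  - by apply: bounded_mfunM; [exact: bounded_mfun_cst|exact: bounded_mfunX].
  apply: le_mean.
  - exact: bounded_mfun_norm.
  - apply: bounded_mfunD; first exact: bounded_mfun_cst.
    by apply: bounded_mfunM; [exact: bounded_mfun_cst|exact: bounded_mfunX].
  (* AM-GM in the form [u <= th / 2 + u ^+ 2 / (2 th)]; the gap is a multiple of a square. *)
  move=> w; rewrite -[(_ - _) ^+ 2]real_normK ?num_real//; set u := `|_|.
  rewrite -subr_ge0.
  have -> : th / 2 + (2 * th)^-1 * u ^+ 2 - u = (2 * th)^-1 * (u - th) ^+ 2.
    by field; rewrite gt_eqF.
  by rewrite mulr_ge0 ?sqr_ge0// invr_ge0 mulr_ge0// ltW.
have -> : (4 + sigma ^+ 2 / (8 * n%:R * h ^+ 2 * th)) * mean_kernel h x + th / 2 =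
  2 * mean_kernel h x +
  ((th / 2 + sigma ^+ 2 / (8 * n%:R * h ^+ 2 * th) * mean_kernel h x) +
   2 * mean_kernel h x).
  by ring.
have hWZ : `|E W - E Z| <= E (fun w => `|Z w - W w|).
  by rewrite distrC -meanB//; apply: dist_mean_le; exact: bounded_mfunB.
apply: (@le_trans _ _ (E (fun w => `|Z w - W w|) +
  (E (fun w => `|W w - E W|) + `|E W - E Z|))); last first.
  by rewrite lerD// lerD// (le_trans hWZ).
rewrite -(mean_cst P `|E W - E Z|) -meanD; last 2 first.
- exact: bounded_mfun_norm.
- exact: bounded_mfun_cst.
rewrite -meanD//; last first.
  by apply: bounded_mfunD; [exact: bounded_mfun_norm|exact: bounded_mfun_cst].
apply: le_mean => //.
  apply: bounded_mfunD => //.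
  by apply: bounded_mfunD; [exact: bounded_mfun_norm|exact: bounded_mfun_cst].
move=> w; rewrite mean_dfE -/(Z w) -/(E Z).
have -> : Z w - E Z = (Z w - W w) + ((W w - E W) + (E W - E Z)) by ring.
rewrite (le_trans (ler_normD _ _))// lerD2l; exact: ler_normD.
Qed.

(** [1 - F_n] averages the indicators of [x < X_i], each at most twice a logistic function, so its
    mean is at most [2 B]. The mean deviation of a nonnegative variable is at most twice its
    mean. *)
Lemma mean_dist_edf_upper l x B : 0 < l -> (0 < n)%N ->
  (forall i, E (fun w => s (- (l * x) + l * Y i w)) <= B) -> G x <= 4 * B.
Proof.
move=> l0 n0 hB.
have bs i := bounded_mfun_logistic (- (l * x)) l (measurable_coord X i).
pose Z w := 1 - edf (X w) x.
have bZ : bounded_mfun Z.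
  by apply: bounded_mfunB; [exact: bounded_mfun_cst|exact: bounded_mfun_edf].
have EZ : E Z = 1 - mean_df X x.
  by rewrite /Z meanB ?mean_cst ?mean_dfE//; [exact: bounded_mfun_cst|exact: bounded_mfun_edf].
have Z0 w : 0 <= Z w by rewrite subr_ge0 edf_le1.
have hZ : E Z <= 2 * B.
  apply: (@le_trans _ _ (2 / n%:R * E (fun w => \sum_i s (- (l * x) + l * Y i w)))).
    rewrite -meanZ; last exact: bounded_mfun_sum.
    apply: le_mean => //.
      by apply: bounded_mfunM; [exact: bounded_mfun_cst|exact: bounded_mfun_sum].
    move=> w; rewrite /Z edfE.
    have e1 : 1 = \sum_(i < n) n%:R^-1 :> R.
      by rewrite sumr_const card_ord -[_^-1 *+ _]mulr_natl mulfV// pnatr_eq0 -lt0n.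
    rewrite [X in X - _ <= _]e1 -sumrB mulr_sumr; apply: ler_sum => i _.
    rewrite [2 / _]mulrC -mulrA -[X in X - _]mulr1 -mulrBr ler_wpM2l ?invr_ge0//.
    have p0 := logistic_gt0 (- (l * x) + l * Y i w).
    case: (leP (Y i w) x) => [_|h] /=; first by rewrite subrr mulr_ge0// ltW.
    have : 0 <= - (l * x) + l * Y i w by nra.
    by move=> /logistic_ge_half; lra.
  rewrite mean_sum// mulrAC ler_pdivrMr ?ltr0n// -mulrA ler_pM2l//.
  apply: (@le_trans _ _ (\sum_(i < n) B)); first exact: ler_sum.
  by rewrite sumr_const card_ord mulr_natr.
have -> : 4 * B = 2 * B + 2 * B by ring.
apply: (@le_trans _ _ (E Z + E Z)); last by rewrite lerD.
rewrite -[X in _ + X](mean_cst P (E Z)) -meanD//; last exact: bounded_mfun_cst.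
apply: le_mean => //; first by apply: bounded_mfunD => //; exact: bounded_mfun_cst.
move=> w; rewrite (_ : edf _ _ - _ = E Z - Z w); last by rewrite EZ /Z; ring.
rewrite (le_trans (ler_normB _ _))// addrC !ger0_norm//; exact: mean_ge0.
Qed.

(** The argument for the right tail applies, with [F_n] in place of [1 - F_n]. *)
Lemma mean_dist_edf_lower l x B : 0 < l -> (0 < n)%N ->
  (forall i, E (fun w => s (l * x + - l * Y i w)) <= B) -> G x <= 4 * B.
Proof.
move=> l0 n0 hB.
have bs i := bounded_mfun_logistic (l * x) (- l) (measurable_coord X i).
pose Z w := edf (X w) x.
have bZ : bounded_mfun Z by exact: bounded_mfun_edf.
have Z0 w : 0 <= Z w by exact: edf_ge0.
have hZ : E Z <= 2 * B.
  apply: (@le_trans _ _ (2 / n%:R * E (fun w => \sum_i s (l * x + - l * Y i w)))).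
    rewrite -meanZ; last exact: bounded_mfun_sum.
    apply: le_mean => //.
      by apply: bounded_mfunM; [exact: bounded_mfun_cst|exact: bounded_mfun_sum].
    move=> w; rewrite /Z edfE mulr_sumr; apply: ler_sum => i _.
    rewrite [2 / _]mulrC -mulrA ler_wpM2l ?invr_ge0//.
    have p0 := logistic_gt0 (l * x + - l * Y i w).
    case: (leP (Y i w) x) => [h|_] /=; last by rewrite mulr_ge0// ltW.
    have : 0 <= l * x + - l * Y i w by nra.
    by move=> /logistic_ge_half; lra.
  rewrite mean_sum// mulrAC ler_pdivrMr ?ltr0n// -mulrA ler_pM2l//.
  apply: (@le_trans _ _ (\sum_(i < n) B)); first exact: ler_sum.
  by rewrite sumr_const card_ord mulr_natr.
have -> : 4 * B = 2 * B + 2 * B by ring.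
apply: (@le_trans _ _ (E Z + E Z)); last by rewrite lerD.
rewrite -[X in _ + X](mean_cst P (E Z)) -meanD//; last exact: bounded_mfun_cst.
apply: le_mean => //; first by apply: bounded_mfunD => //; exact: bounded_mfun_cst.
move=> w; rewrite mean_dfE -/(Z w) -/(E Z) (le_trans (ler_normB _ _))// !ger0_norm//.
exact: mean_ge0.
Qed.

End pointwise.

(** * Integration over the line *)

Section integration.
Context {d} {T : measurableType d} {R : realType} (P : probability T R) (n : nat).
Variables (X : {RV P >-> n.-tuple (measurableTypeR R)}).
Local Notation mu := (@lebesgue_measure R).
Local Notation E f := (Rintegral P setT f).
Local Notation Y i w := (tnth (X w) i).
Local Notation k := (@logistic_density R).

Let kY h (i : 'I_n) (z : T * measurableTypeR R) : \bar R :=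
  (k (h^-1 * z.2 + - h^-1 * Y i z.1))%:E.

Let mkY h i : measurable_fun setT (kY h i).
Proof.
apply/measurable_EFinP; apply: (measurableT_comp measurable_logistic_density).
apply: measurable_funD; apply: measurable_funM => //.
exact: (measurableT_comp (measurable_coord X i) measurable_fst).
Qed.

Let kY0 h i z : (0 <= kY h i z)%E.
Proof. by rewrite lee_fin logistic_density_ge0. Qed.

Let EkY h i x : (\int[P]_w kY h i (w, x))%E =
  (E (fun w => k (h^-1 * x + - h^-1 * Y i w)))%:E.
Proof.
exact: (EFin_mean P (bounded_mfun_logistic_density (h^-1 * x) (- h^-1) (measurable_coord X i))).
Qed.

(** Measurability in [x] of the partial integral over [T] is part of Tonelli's theorem. *)
Let mEkY h i : measurable_fun setT (fun x : measurableTypeR R =>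
  (E (fun w => k (h^-1 * x + - h^-1 * Y i w)))%:E).
Proof.
under eq_fun do rewrite -EkY.
exact: (@measurable_fun_fubini_tonelli_G _ _ _ _ _ P _ (mkY h i) (kY0 h i)).
Qed.

Lemma measurable_mean_kernel h : measurable_fun [set: R] (mean_kernel X h).
Proof.
apply: measurable_funM => //.
apply: measurable_sum => i; apply/measurable_EFinP; exact: mEkY.
Qed.

Lemma mean_kernel_ge0 h x : 0 <= mean_kernel X h x.
Proof.
rewrite mulr_ge0 ?invr_ge0//; apply: sumr_ge0 => i _.
by apply: mean_ge0 => w; exact: logistic_density_ge0.
Qed.

(** By Tonelli the integral over [x] can be taken first; it equals [h] whatever the value of
    [X_i]. *)
Lemma integral_mean_kernel h : (0 < n)%N -> 0 < h ->
  (\int[mu]_x (mean_kernel X h x)%:E = h%:E)%E.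
Proof.
move=> n0 h0.
have ii i : (\int[mu]_x (E (fun w => k (h^-1 * x + - h^-1 * Y i w)))%:E = h%:E)%E.
  under eq_integral do rewrite -EkY.
  rewrite -(fubini_tonelli (m1 := P) (m2 := mu) (kY h i))//.
  rewrite -[RHS]mule1 -(@probability_setT _ _ _ P) -integral_cst//.
  apply: eq_integral => w _; rewrite /kY /=.
  rewrite -(integral_affine_logistic_density (- h^-1 * Y i w) h0).
  by apply: eq_integral => x _; rewrite addrC.
under eq_integral do rewrite /mean_kernel EFinM -sumEFin.
have M0 i x : (0 <= (E (fun w => k (h^-1 * x + - h^-1 * Y i w)))%:E)%E.
  by rewrite lee_fin; apply: mean_ge0 => w; exact: logistic_density_ge0.
rewrite ge0_integralZl//; first last.
- by move=> x _; exact: sume_ge0.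
- by apply: emeasurable_sum => i; exact: mEkY.
rewrite ge0_integral_sum//.
under eq_bigr do rewrite ii.
by rewrite sumEFin sumr_const card_ord -EFinM -[h *+ _]mulr_natl mulKf// pnatr_eq0 -lt0n.
Qed.

Let dZ (z : T * measurableTypeR R) : \bar R :=
  (`|edf (X z.1) z.2 - mean_df X z.2|)%:E.

Let mdZ : measurable_fun setT dZ.
Proof.
apply/measurable_EFinP; apply: measurableT_comp => //; apply: measurable_funB.
  under eq_fun do rewrite edfE.
  apply: measurable_sum => i; apply: measurable_funM => //.
  apply: (proj1 (bounded_mfun_ler _ _)).
    exact: (measurableT_comp (measurable_coord X i) measurable_fst).
  exact: measurable_snd.
apply: (measurableT_comp _ measurable_snd).
(* [mean_df] is nondecreasing, hence measurable. *)
apply: nondecreasing_measurable => // x y xy.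
rewrite !mean_dfE; apply: le_mean; try exact: bounded_mfun_edf.
move=> w; rewrite !edfE; apply: ler_sum => i _; rewrite ler_wpM2l ?invr_ge0// ler_nat.
by case: (leP (Y i w) x) => // h; rewrite (le_trans h xy).
Qed.

Let bdZ x : bounded_mfun (fun w => `|edf (X w) x - mean_df X x|).
Proof.
apply: bounded_mfun_norm; apply: bounded_mfunB; first exact: bounded_mfun_edf.
exact: bounded_mfun_cst.
Qed.

(** Tonelli exchanges the two integrals, so a pointwise bound on the mean deviation suffices. *)
Lemma mean_integral_edf_le (H : R -> R) : measurable_fun setT H ->
  (forall x, E (fun w => `|edf (X w) x - mean_df X x|) <= H x) ->
  (\int[P]_w \int[mu]_x `|edf (X w) x - mean_df X x|%:E <= \int[mu]_x (H x)%:E)%E.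
Proof.
move=> mH hH.
have dZ0 z : (0 <= dZ z)%E by rewrite lee_fin.
rewrite (fubini_tonelli (m1 := P) (m2 := mu) dZ mdZ dZ0).
apply: ge0_le_integral => //.
- by move=> x _; apply: integral_ge0 => w _; rewrite lee_fin.
- by apply: (@measurable_fun_fubini_tonelli_G _ _ _ _ _ P _ mdZ dZ0).
- exact/measurable_EFinP.
- by move=> x _; rewrite /dZ/= EFin_mean// lee_fin.
Qed.

End integration.

(** * Spread of the means, and a lower bound for the logarithm *)

Section spread.
Context {d} {T : measurableType d} {R : realType} (P : probability T R) (n : nat).
Variables (X : {RV P >-> n.-tuple (measurableTypeR R)}) (sigma : R).
Hypothesis sigma_gt0 : 0 < sigma.

Lemma mean_spread_ge0 : 0 <= mean_spread X sigma.
Proof.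
apply: mulr_ge0; first by rewrite invr_ge0 ltW.
elim/big_ind : _ => // [x y x0 y0|i _]; first by rewrite le_max x0.
by elim/big_ind : _ => // x y x0 y0; rewrite le_max x0.
Qed.

Lemma dist_mean_coord_le (i j : 'I_n) :
  `|mean_coord X i - mean_coord X j| <= sigma * mean_spread X sigma.
Proof.
rewrite /mean_spread mulrA mulfV ?gt_eqF// mul1r.
apply: (bigmax_sup i) => //; exact: (bigmax_sup j).
Qed.

End spread.

(** From [expR (- 1/2) >= 1 - 1/2] follows [expR (1/2) <= 2]. This serves to absorb [1/n] into
    [(A + ln n) / n]. *)
Lemma half_le_ln (R : realType) (n : nat) : (2 <= n)%N -> 2^-1 <= ln n%:R :> R.
Proof.
move=> n2.
have h : 2^-1 <= expR (- 2^-1) :> R by apply: le_trans (expR_ge1Dx _); lra.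
have h2 : expR 2^-1 <= 2 :> R.
  rewrite -[leLHS]opprK -(opprK 2^-1) expRN opprK -[leRHS]invrK.
  by rewrite lef_pV2 ?posrE ?invr_gt0 ?expR_gt0.
rewrite -ler_expR lnK ?posrE ?ltr0n; last exact: leq_trans n2.
by rewrite (le_trans h2)// ler_nat.
Qed.

(** * A single pointwise bound on the whole line, and its integral *)

Section pointwise_bound.
Context {d} {T : measurableType d} {R : realType} (P : probability T R) (n : nat).
Variables (X : {RV P >-> n.-tuple (measurableTypeR R)}) (sigma : R).
Hypotheses (sigma_gt0 : 0 < sigma) (PIX : PI (distribution P X) (sigma ^+ 2)).
Hypothesis n0 : (0 < n)%N.
Local Notation E f := (Rintegral P setT f).
Local Notation k := (@logistic_density R).
Let l := (2 * sigma)^-1.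

(** The margin [2 * sigma * ln n] between the means and the ends of the interval is worth a factor
    [1/n], as [l * (2 * sigma) = 1]. The remaining exponential, in the distance from [x] to the
    interval, is at most [4 k]. The sum of two densities covers both sides at once. *)
Lemma mean_dist_edf_tail (c r x : R) :
  (forall i, `|mean_coord X i - c| <= r - 2 * sigma * ln n%:R) ->
  r < `|x - c| ->
  E (fun w => `|edf (X w) x - mean_df X x|) <=
    16 * @tail_cst R / n%:R * (k (- (l * (c + r)) + l * x) + k (- (l * (c - r)) + l * x)).
Proof.
move=> hc hx.
have l0 : 0 < l by rewrite invr_gt0 mulr_gt0.
have lE : l * (2 * sigma) = 1 by rewrite mulVf// gt_eqF// mulr_gt0.
have nR : 0 < n%:R :> R by rewrite ltr0n.
have tc0 : 0 <= @tail_cst R by rewrite /tail_cst !mulr_ge0// expR_ge0.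
have key t u : 0 <= t -> u <= - ln n%:R - t ->
    tail_cst * expR u <= @tail_cst R / n%:R * (4 * k t).
  move=> t0 ut; rewrite -[leRHS]mulrA ler_wpM2l//.
  apply: (@le_trans _ _ (expR (- ln n%:R - t))); first by rewrite ler_expR.
  rewrite expRD (expRN (ln _)) lnK ?posrE//; apply: ler_wpM2l; first by rewrite invr_ge0 ltW.
  exact: expRN_le_logistic_density.
have k0 u := @logistic_density_ge0 R u.
have cn0 : 0 <= @tail_cst R / n%:R by rewrite mulr_ge0// invr_ge0 ltW.
have [xc|xc] := ltP 0 (x - c).
  rewrite gtr0_norm// in hx.
  pose t := - (l * (c + r)) + l * x.
  have t0 : 0 <= t by rewrite /t addrC -mulrBr mulr_ge0 ?ltW//; lra.
  (* The constant 16 is the 4 of the deviation bound times the 4 of [expRN_le_logistic_density]. *)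
  apply: (@le_trans _ _ (4 * (tail_cst / n%:R * (4 * k t)))).
    apply: (mean_dist_edf_upper l0) => // i.
    apply: (le_trans (proj1 (coordinate_tail sigma_gt0 PIX i x))); rewrite -/l.
    apply: key => //.
    have := le_trans (ler_norm _) (hc i) => h.
    have := ler_wpM2l (ltW l0) h; rewrite !mulrBr mulrA lE mul1r /t; lra.
  rewrite -/t; have := mulr_ge0 cn0 (k0 (- (l * (c - r)) + l * x)).
  set z := k (- (l * (c - r)) + _); rewrite -(mulrA 16).
  set a := tail_cst / _ => ?; nra.
rewrite ler0_norm// in hx.
pose t := - (- (l * (c - r)) + l * x).
have t0 : 0 <= t by rewrite /t opprD opprK -mulrBr mulr_ge0 ?ltW//; lra.
apply: (@le_trans _ _ (4 * (tail_cst / n%:R * (4 * k t)))).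
  apply: (mean_dist_edf_lower l0) => // i.
  apply: (le_trans (proj2 (coordinate_tail sigma_gt0 PIX i x))); rewrite -/l.
  apply: key => //.
  have : - (mean_coord X i - c) <= r - 2 * sigma * ln n%:R.
    by apply: le_trans (hc i); rewrite -normrN ler_norm.
  move=> h; have := ler_wpM2l (ltW l0) h; rewrite mulrN !mulrBr mulrA lE mul1r /t; lra.
rewrite /t logistic_densityN.
have := mulr_ge0 cn0 (k0 (- (l * (c + r)) + l * x)).
set z := k (- (l * (c + r)) + _); rewrite -(mulrA 16).
  set a := tail_cst / _ => ?; nra.
Qed.

(** All terms are nonnegative, so the sum dominates whichever of the bulk and tail estimates is
    used; the indicator keeps the constant [th / 2] integrable. *)
Lemma mean_dist_edf_le (c r h th x : R) : 0 < h -> 0 < th ->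
  (forall i, `|mean_coord X i - c| <= r - 2 * sigma * ln n%:R) ->
  E (fun w => `|edf (X w) x - mean_df X x|) <=
    (4 + sigma ^+ 2 / (8 * n%:R * h ^+ 2 * th)) * mean_kernel X h x +
    (th / 2 * \1_(`[c - r, c + r]%classic : set R) x +
     16 * @tail_cst R / n%:R * (k (- (l * (c + r)) + l * x) + k (- (l * (c - r)) + l * x))).
Proof.
move=> h0 th0 hc.
have tl0 : 0 <= 16 * @tail_cst R / n%:R *
    (k (- (l * (c + r)) + l * x) + k (- (l * (c - r)) + l * x)).
  by rewrite mulr_ge0 ?addr_ge0 ?logistic_density_ge0// /tail_cst !mulr_ge0 ?expR_ge0// invr_ge0.
have C0 : 0 <= (4 + sigma ^+ 2 / (8 * n%:R * h ^+ 2 * th)) * mean_kernel X h x.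
  apply: mulr_ge0; last exact: mean_kernel_ge0.
  by rewrite addr_ge0// mulr_ge0 ?sqr_ge0// invr_ge0 !mulr_ge0 ?sqr_ge0// ltW.
have [hx|hx] := ltP r `|x - c|.
  apply: (le_trans (mean_dist_edf_tail hc hx)).
  by rewrite addrA lerDr addr_ge0// mulr_ge0// divr_ge0// ltW.
apply: (le_trans (mean_dist_edf_bulk x n0 h0 th0 PIX)).
rewrite indicE mem_set; first by rewrite mulr1 addrA lerDl.
by move: hx; rewrite ler_distl /= in_itv.
Qed.

End pointwise_bound.

(** The kernel integrates to [h], the indicator to [2 r] and each logistic density to [2 sigma],
    whence [64 = 16 * 4]. *)
Lemma integral_edf_le {d} {T : measurableType d} {R : realType} (P : probability T R)
    (n : nat) (X : {RV P >-> n.-tuple (measurableTypeR R)}) (sigma c r h th : R) :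
  (0 < n)%N -> 0 < sigma -> PI (distribution P X) (sigma ^+ 2) ->
  0 < h -> 0 < th -> 0 <= r ->
  (forall i, `|mean_coord X i - c| <= r - 2 * sigma * ln n%:R) ->
  (\int[P]_w \int[@lebesgue_measure R]_x `|edf (X w) x - mean_df X x|%:E <=
   ((4 + sigma ^+ 2 / (8 * n%:R * h ^+ 2 * th)) * h + (th * r +
     64 * @tail_cst R / n%:R * sigma))%:E)%E.
Proof.
move=> n0 s0 PIX h0 th0 r0 hc.
pose mu := @lebesgue_measure R.
set l := (2 * sigma)^-1.
set C1 := 4 + _.
set C2 := 16 * @tail_cst R / n%:R.
have C10 : 0 <= C1.
  by rewrite addr_ge0// mulr_ge0 ?sqr_ge0// invr_ge0 !mulr_ge0 ?sqr_ge0// ltW.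
have C20 : 0 <= C2 by rewrite /C2 /tail_cst !mulr_ge0 ?expR_ge0// invr_ge0.
pose k a x := @logistic_density R (a + l * x).
pose a1 := - (l * (c + r)); pose a2 := - (l * (c - r)).
pose I : R -> R := \1_(`[c - r, c + r]%classic : set R).
pose kk x := k a1 x + k a2 x.
pose f1 x := C1 * mean_kernel X h x.
pose f2 x := th / 2 * I x.
pose f3 x := C2 * kk x.
pose f23 x := f2 x + f3 x.
have mk a : measurable_fun setT (k a) by exact: measurable_affine_logistic_density.
have mI : measurable_fun setT I by exact: measurable_indic.
have mM := measurable_mean_kernel X h.
have k0 a x : 0 <= k a x by exact: logistic_density_ge0.
have mkk : measurable_fun setT kk by exact: measurable_funD.
have kk0 x : 0 <= kk x by exact: addr_ge0.
have mf1 : measurable_fun setT f1 by exact: measurable_funM.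
have mf2 : measurable_fun setT f2 by exact: measurable_funM.
have mf3 : measurable_fun setT f3 by exact: measurable_funM.
have mf23 : measurable_fun setT f23 by exact: measurable_funD.
have f10 x : 0 <= f1 x by rewrite mulr_ge0// mean_kernel_ge0.
have th20 : 0 <= th / 2 by rewrite divr_ge0// ltW.
have f20 x : 0 <= f2 x by rewrite mulr_ge0.
have f30 x : 0 <= f3 x by rewrite mulr_ge0.
have f230 x : 0 <= f23 x by exact: addr_ge0.
have ID (f g : R -> R) : measurable_fun setT f -> measurable_fun setT g ->
    (forall x, 0 <= f x) -> (forall x, 0 <= g x) ->
    (\int[mu]_x (f x + g x)%:E = \int[mu]_x (f x)%:E + \int[mu]_x (g x)%:E)%E.
  move=> mf mg f0 g0; under eq_integral do rewrite EFinD.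
  by rewrite ge0_integralD//; (try exact/measurable_EFinP) => x _; rewrite lee_fin.
have IZ (C : R) (f : R -> R) : 0 <= C -> measurable_fun setT f -> (forall x, 0 <= f x) ->
    (\int[mu]_x (C * f x)%:E = C%:E * \int[mu]_x (f x)%:E)%E.
  move=> C0 mf f0; under eq_integral do rewrite EFinM.
  by rewrite ge0_integralZl//; (try exact/measurable_EFinP) => x _; rewrite lee_fin.
have Ikk : (\int[mu]_x (kk x)%:E = (4 * sigma)%:E)%E.
  rewrite (ID _ _ (mk a1) (mk a2))//.
  rewrite !integral_affine_logistic_density ?mulr_gt0// -EFinD; congr (_%:E); ring.
have II : (\int[mu]_x (I x)%:E = (2 * r)%:E)%E.
  rewrite integral_indic//= setIT lebesgue_measure_itv/= lte_fin.
  case: ltP => hr; first by rewrite -EFinB; congr (_%:E); ring.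
  (* Here [r = 0] and the interval is a point. *)
  by congr (_%:E); lra.
apply: (le_trans (@mean_integral_edf_le _ _ _ _ _ X (fun x => f1 x + f23 x) _ _)).
- exact: measurable_funD.
- by move=> x; exact: mean_dist_edf_le.
rewrite (ID _ _ mf1 mf23)// (ID _ _ mf2 mf3)//.
rewrite (IZ _ _ C10 mM (mean_kernel_ge0 X h)) integral_mean_kernel//.
rewrite (IZ _ _ th20 mI)// (IZ _ _ C20 mkk)// II Ikk.
rewrite -!(EFinM, EFinD) lee_fin le_eqVlt; apply/orP; left; apply/eqP; rewrite /C2; field.
by rewrite pnatr_eq0 -lt0n.
Qed.

(** * Choice of the parameters *)

Theorem theorem1p1 (R : realType) :
  exists C : R, 0 < C /\
    forall (n : nat) (sigma : R) (d : measure_display) (T : measurableType d)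
      (P : probability T R) (X : {RV P >-> n.-tuple (measurableTypeR R)}),
      (2 <= n)%N -> 0 < sigma ->
      PI (distribution P X) (sigma ^+ 2) ->
      (\int[P]_w \int[@lebesgue_measure R]_x `|edf (X w) x - mean_df X x|%:E
       <= (C * sigma *
             ((mean_spread X sigma + ln n%:R) / n%:R) `^ (3%:R^-1))%:E)%E.
Proof.
have tc0 : 0 <= @tail_cst R by rewrite /tail_cst !mulr_ge0// expR_ge0.
(* The contributions [4 + 1/8] of the kernel and 2 of [th * r] sum to less than 7; [128 = 64 * 2]
   comes from [1/n <= 2 q]. *)
exists (7 + 128 * @tail_cst R); split; first lra.
move=> n sigma d T P X n2 s0 PIX.
have n0 : (0 < n)%N by exact: leq_trans n2.
have nR : 0 < n%:R :> R by rewrite ltr0n.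
have A0 := mean_spread_ge0 X s0.
have hd := dist_mean_coord_le X s0.
have hln := @half_le_ln R n n2.
set A := mean_spread X sigma in A0 hd *.
set q := _ `^ _.
have L0 : 0 < (A + ln n%:R) / n%:R by rewrite divr_gt0//; lra.
have q0 : 0 < q by exact: powR_gt0.
have q3 : q ^+ 3 = (A + ln n%:R) / n%:R.
  by rewrite -powR_mulrn ?ltW// -powRrM mulVf ?powRr1// ltW.
(* [A >= 0] and [ln n >= 1/2] give [1/n <= 2 q^3], which suffices for [q <= 1]; otherwise
   [1/n <= 1 < q]. *)
have qn : n%:R^-1 <= 2 * q.
  have h : n%:R^-1 <= 2 * q ^+ 3.
    rewrite q3 mulrA -[leLHS]mul1r; apply: ler_wpM2r; last lra.
    by rewrite invr_ge0 ltW.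
  have [q1|q1] := leP q 1.
    apply: (le_trans h); rewrite ler_pM2l// exprS -[leRHS]mulr1.
    by apply: ler_wpM2l; [exact: ltW|apply: exprn_ile1 => //; exact: ltW].
  have : n%:R^-1 <= 1 :> R by rewrite invf_le1// ler1n.
  lra.
pose r := sigma * A + 2 * sigma * ln n%:R.
pose th := (n%:R * q ^+ 2)^-1.
have th0 : 0 < th by rewrite invr_gt0 mulr_gt0// exprn_gt0.
have ln0 : 0 <= ln n%:R :> R by lra.
have r0 : 0 <= r by apply: addr_ge0; apply: mulr_ge0; rewrite // ?(mulr_ge0 _ (ltW s0)) ?(ltW s0).
(* Any one mean serves as centre, since all others lie within [sigma * A] of it. *)
pose c := mean_coord X (Ordinal n0).
have hc i : `|mean_coord X i - c| <= r - 2 * sigma * ln n%:R.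
  by rewrite /r addrK; exact: hd.
apply: (le_trans (integral_edf_le n0 s0 PIX (mulr_gt0 s0 q0) th0 r0 hc)).
rewrite lee_fin.
(* The choice of [th] makes [n * h ^+ 2 * th = sigma ^+ 2] for [h = sigma * q]. *)
have -> : sigma ^+ 2 / (8 * n%:R * (sigma * q) ^+ 2 * th) = 8^-1.
  by rewrite /th; field; rewrite !gt_eqF.
(* [A + 2 ln n <= 2 (A + ln n) = 2 n q^3], and [th] divides by [n q^2]. *)
have hth : th * r <= 2 * (sigma * q).
  have -> : 2 * (sigma * q) = th * (2 * sigma * (A + ln n%:R)).
    have -> : A + ln n%:R = n%:R * q ^+ 3 by rewrite q3 mulrCA mulfV ?mulr1// gt_eqF.
    by rewrite /th; field; rewrite !gt_eqF.
  apply: ler_wpM2l; first exact: ltW.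
  by rewrite /r; nra.
have htl : 64 * @tail_cst R / n%:R * sigma <= 128 * tail_cst * (sigma * q).
  have -> : 128 * tail_cst * (sigma * q) = 64 * @tail_cst R * (2 * q) * sigma by ring.
  apply: ler_wpM2r; first exact: ltW.
  by apply: ler_wpM2l; first exact: mulr_ge0.
have sq : 0 < sigma * q by exact: mulr_gt0.
rewrite -mulrA; nra.
Qed.
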